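(* For every positive integer $n$, the number $G_1(n)$ of complete Gessel words of length $2n$ in which each of the letters $1$ and $\bar{1}$ occurs exactly once (so that each of $2$ and $\bar{2}$ occurs exactly $n-1$ times) is $$G_1(n)=\frac{2n+1}{2}\binom{2n}{n}-2^{2n-1}.$$
   Context: Words are finite sequences over the four-letter alphabet $\{1,2,\bar{1},\bar{2}\}$. For a word $x$ and a letter $\alpha$, $N_\alpha(x)$ denotes the number of occurrences of $\alpha$ in $x$. A word $w$ is a Gessel word if every prefix $x$ of $w$ satisfies $N_2(x)-N_{\bar{2}}(x)\ge 0$ and $N_2(x)+N_1(x)-N_{\bar{2}}(x)-N_{\bar{1}}(x)\ge 0$. A Gessel word $w$ is complete if in addition $N_1(w)=N_{\bar{1}}(w)$ and $N_2(w)=N_{\bar{2}}(w)$. *)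

(* Defs.v *)
From HB Require Import structures.
From mathcomp Require Import all_boot all_order all_algebra.

Set Implicit Arguments.
Unset Strict Implicit.
Unset Printing Implicit Defensive.

Import Order.TTheory GRing.Theory Num.Theory.

Local Open Scope ring_scope.

(* [L1b] and [L2b] are the barred letters. *)
Inductive letter := L1 | L2 | L1b | L2b.

(* Encoding used only to derive the finite type structure of [letter]. *)
Definition letter_code (a : letter) : bool * bool :=
  match a with
  | L1 => (false, false) | L2 => (true, false)
  | L1b => (false, true) | L2b => (true, true)
  end.

Definition letter_decode (c : bool * bool) : letter :=
  match c with
  | (false, false) => L1 | (true, false) => L2
  | (false, true) => L1b | (true, true) => L2b
  end.

Lemma letter_codeK : cancel letter_code letter_decode.
Proof. by case. Qed.

HB.instance Definition _ := Finite.copy letter (can_type letter_codeK).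

(* Integer valued, so that the differences below are not truncated. *)
Definition N (a : letter) (x : seq letter) : int := (count_mem a x)%:Z.

Definition gessel_cond (x : seq letter) : bool :=
  (0 <= N L2 x - N L2b x) && (0 <= N L2 x + N L1 x - N L2b x - N L1b x).

(* The prefixes of [w] are the [take i w] with [i <= size w]; see [gesselP]. *)
Definition gessel (w : seq letter) : bool :=
  all (fun i => gessel_cond (take i w)) (iota 0 (size w).+1).

Lemma gesselP (w : seq letter) :
  reflect (forall x, prefix x w -> gessel_cond x) (gessel w).
Proof.
apply: (iffP allP) => [gw x /prefixP[y def_w]|gw i _].
  rewrite -(take_size_cat y (erefl (size x))) -def_w; apply: gw.
  by rewrite mem_iota add0n /= ltnS def_w size_cat leq_addr.
exact/gw/prefix_take.
Qed.

Definition complete_gessel (w : seq letter) : bool :=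
  [&& gessel w, N L1 w == N L1b w & N L2 w == N L2b w].

Definition G1 (n : nat) : nat :=
  #|[set w : (2 * n).-tuple letter |
       [&& complete_gessel w, N L1 w == 1 & N L1b w == 1]]|.

(* Main.v *)
Require Import Defs.
From HB Require Import structures.
From mathcomp Require Import all_boot all_order all_algebra.
From mathcomp Require Import zify ring lra.
Import GRing.Theory Num.Theory.
Local Open Scope ring_scope.

(** Read the word from left to right, recording the height [h = N_2 - N_2bar] and which
    of the letters [1], [1bar] have occurred.  In each of the four states the
    number of completions that use [p] further letters [2] has a closed form:
    with [M = 2p + h + 1],
    - both occurred: [2 C(M - 1, p) - C(M, p)] (ballot numbers);
    - only [1] occurred: [(h + 1) C(M, p)];
    - only [1bar] occurred: [h C(M, p)], because the second Gessel condition
      then amounts to [h >= 1], which is also why this vanishes at [h = 0];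
    - neither occurred: [(h + 1) (M C(M, p) - 2 sum_(i < p) C(M, i))].
    All four satisfy the first-letter recurrence, by Pascal's rule.  The
    theorem is the last formula at [h = 0], [p = n - 1], where [M = 2n - 1] and
    the sum is half a row of Pascal's triangle up to its middle term. *)

(** * Counting words by their first letter *)

Section CountTuples.

Variable T : finType.

Definition count_tuples (l : nat) (Q : pred (seq T)) : nat :=
  #|[set w : l.-tuple T | Q w]|.

Lemma count_tuplesE l Q : count_tuples l Q = (\sum_(w : l.-tuple T) Q w)%N.
Proof.
rewrite /count_tuples cardsE -sum1_card big_mkcond /=.
by apply: eq_bigr => w _; rewrite unfold_in /=; case: (Q w).
Qed.

Lemma count_tuples_eq0 l Q :
  (forall w, size w = l -> ~~ Q w) -> count_tuples l Q = 0%N.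
Proof.
move=> Q0; rewrite count_tuplesE big1 // => w _.
by rewrite (negbTE (Q0 w (size_tuple w))).
Qed.

Lemma count_tuples0 Q : count_tuples 0 Q = Q [::].
Proof.
rewrite count_tuplesE (eq_bigr (fun=> (Q [::] : nat))); last by move=> w _; rewrite tuple0.
by rewrite sum_nat_const card_tuple mul1n.
Qed.

Lemma count_tuplesS l Q :
  count_tuples l.+1 Q = (\sum_(a : T) count_tuples l (fun w => Q (a :: w)))%N.
Proof.
rewrite count_tuplesE (eq_bigr (fun a => \sum_(w : l.-tuple T) Q (a :: w)))%N; last first.
  by move=> a _; rewrite count_tuplesE.
rewrite pair_big /=.
rewrite (reindex (fun p : T * l.-tuple T => cons_tuple p.1 p.2)) //=.
exists (fun w : l.+1.-tuple T => (thead w, behead_tuple w)) => [[a w] _|w _].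
  by congr (_, _); apply: val_inj.
by rewrite [RHS]tuple_eta; apply: val_inj.
Qed.

End CountTuples.

Lemma sum_letter (F : letter -> nat) :
  (\sum_a F a = F L1 + F L2 + F L1b + F L2b)%N.
Proof.
rewrite (bigD1 L1) //= (bigD1 L2) //= (bigD1 L1b) //= (bigD1 L2b) //= big_pred0 ?addn0 ?addnA //.
by case.
Qed.

(** * Letter-by-letter recognition of the words counted by [G1] *)

(* [h] is the current height; [u] and [v] tell whether [1] and [1bar] have
   already been read. *)
Fixpoint accepts (h : nat) (u v : bool) (w : seq letter) : bool :=
  match w with
  | [::] => [&& h == 0, u & v]
  | L1 :: w => ~~ u && accepts h true v w
  | L2 :: w => accepts h.+1 u v w
  | L1b :: w => [&& ~~ v, (0 < h + u)%N & accepts h u true w]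
  | L2b :: w => [&& (0 < h)%N, (v < h + u)%N & accepts h.-1 u v w]
  end.

(** Returning to height 0 takes at least [h] letters [L2b], besides any missing [L1] or [L1b]. This
    bound kills the boundary terms of the recurrence. *)
Lemma accepts_size h u v w :
  accepts h u v w -> (h + ~~ u + ~~ v <= size w)%N.
Proof.
elim: w h u v => [|[] w IH] h u v /=; first by case/and3P=> /eqP-> -> ->.
- by case/andP=> nu /IH /=; lia.
- by move=> /IH /=; lia.
- by case/and3P=> nv _ /IH /=; lia.
- by case/and3P=> h0 _ /IH /=; lia.
Qed.

(** The Gessel conditions for [x] preceded by a word of height [h] with [u] letters [L1] and [v]
    letters [L1b]. *)
Definition gessel_cond_from (h u v : int) (x : seq letter) : bool :=
  (0 <= h + N L2 x - N L2b x) &&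
  (0 <= h + u - v + N L2 x + N L1 x - N L2b x - N L1b x).

(** By the hypothesis the empty prefix passes; every other prefix is tested from the state reached
    after the first letter. *)
Lemma acceptsE h (u v : bool) w : (v <= h + u)%N ->
  accepts h u v w =
  [&& all (fun i => gessel_cond_from h u v (take i w)) (iota 0 (size w).+1),
      h%:Z + N L2 w == N L2b w, N L1 w + u == 1 & N L1b w + v == 1].
Proof.
elim: w h u v => [|a w IH] h u v vhu.
  rewrite /= /gessel_cond_from /N /=.
  by apply/idP/idP; case: u vhu; case: v => //=; lia.
have -> : iota 0 (size (a :: w)).+1 = 0%N :: map succn (iota 0 (size w).+1).
  by rewrite -[in RHS](iotaDl 1).
have hd : gessel_cond_from h u v (take 0 (a :: w)).
  by rewrite take0 /gessel_cond_from /N /=; lia.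
rewrite (_ : all _ (_ :: _) = all (fun i => gessel_cond_from h u v
    (take i.+1 (a :: w))) (iota 0 (size w).+1)); last first.
  by rewrite [LHS]/= hd all_map.
have step (h' : nat) (u' v' : bool) :
   (forall x, gessel_cond_from h u v (a :: x) = gessel_cond_from h' u' v' x) ->
   all (fun i => gessel_cond_from h u v (take i.+1 (a :: w))) (iota 0 (size w).+1)
   = all (fun i => gessel_cond_from h' u' v' (take i w)) (iota 0 (size w).+1).
  by move=> E; apply: eq_all => i /=; rewrite E.
(* When a guard of [accepts] fails, the one-letter prefix already violates a Gessel condition. *)
have first_cond :
    all (fun i => gessel_cond_from h u v (take i.+1 (a :: w))) (iota 0 (size w).+1) ->
    gessel_cond_from h u v [:: a].
  by move=> /= /andP[]; rewrite take0.
have cnt_ge0 b : 0 <= N b w by [].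
case: a {IH} (IH) hd step first_cond => IH hd step first_cond.
- case: u vhu hd step first_cond => vhu hd step first_cond.
    apply/esym/negbTE/negP => /and4P[_ _ /eqP + _].
    by have := cnt_ge0 L1; rewrite /N /=; lia.
  rewrite (step h true v) => [|x]; last by rewrite /gessel_cond_from /N /=; lia.
  rewrite [LHS]/= IH; last by lia.
  by congr [&& _, _, _ & _]; rewrite /N /=; lia.
- rewrite (step h.+1 u v) => [|x]; last by rewrite /gessel_cond_from /N /=; lia.
  rewrite [LHS]/= IH; last by lia.
  by congr [&& _, _, _ & _]; rewrite /N /=; lia.
- case: v vhu hd step first_cond => vhu hd step first_cond.
    apply/esym/negbTE/negP => /and4P[_ _ _ /eqP +].
    by have := cnt_ge0 L1b; rewrite /N /=; lia.
  rewrite [LHS]/=; case: (ltnP 0 (h + u)) => hu; last first.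
    apply/esym/negbTE/negP => /and4P[/first_cond + _ _ _].
    by rewrite /gessel_cond_from /N /=; lia.
  rewrite (step h u true) => [|x]; last by rewrite /gessel_cond_from /N /=; lia.
  rewrite [LHS]/= IH; last by lia.
  by congr [&& _, _, _ & _]; rewrite /N /=; lia.
- rewrite [LHS]/=; case: (boolP ((0 < h) && (v < h + u)))%N => hu; last first.
    rewrite andbA (negbTE hu); apply/esym/negbTE/negP => /and4P[/first_cond + _ _ _].
    by rewrite /gessel_cond_from /N /=; lia.
  case/andP: hu => h0 hv.
  rewrite (step h.-1 u v) => [|x]; last by rewrite /gessel_cond_from /N /=; lia.
  rewrite h0 hv /= IH; last by lia.
  by congr [&& _, _, _ & _]; rewrite /N /=; lia.
Qed.

Lemma G1_accepts n : G1 n = count_tuples letter (2 * n) (accepts 0 false false).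
Proof.
rewrite /G1 /count_tuples; apply: eq_card => w; rewrite !inE acceptsE // /complete_gessel /gessel.
rewrite (eq_all (a2 := fun i => gessel_cond (take i w))); last first.
  by move=> i /=; rewrite /gessel_cond_from /gessel_cond.
by case: all => //=; rewrite /N; lia.
Qed.

Definition completions (l h : nat) (u v : bool) : nat :=
  count_tuples letter l (accepts h u v).

Lemma completions_eq0 l h u v :
  (l < h + ~~ u + ~~ v)%N -> completions l h u v = 0%N.
Proof.
move=> l_lt; apply: count_tuples_eq0 => w sw; apply/negP => /accepts_size.
by rewrite sw leqNgt l_lt.
Qed.

Lemma completionsS l h u v :
  completions l.+1 h u v =
  ((if u then 0 else completions l h true v) + completions l h.+1 u v +
   (if ~~ v && (0 < h + u) then completions l h u true else 0) +
   (if (0 < h) && (v < h + u) then completions l h.-1 u v else 0))%N.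
Proof.
rewrite /completions count_tuplesS sum_letter /=.
have count0 Q : Q =1 xpred0 -> count_tuples letter l Q = 0%N.
  by move=> Q0; apply: count_tuples_eq0 => w _; rewrite Q0.
congr (_ + _ + _ + _)%N.
- by case: u; [exact: count0|].
- by case: v => /=; [exact: count0|case: (0 < h + u)%N => //; exact: count0].
- by case: (0 < h)%N; case: (v < h + u)%N => //; apply: count0.
Qed.

Lemma natr_completionsS l h u v :
  (completions l.+1 h u v)%:R =
  (if u then 0 else completions l h true v)%:R + (completions l h.+1 u v)%:R +
  (if ~~ v && (0 < h + u)%N then completions l h u true else 0)%:R +
  (if (0 < h) && (v < h + u) then completions l h.-1 u v else 0)%N%:R :> rat.
Proof. by rewrite completionsS !natrD. Qed.

(** * Closed forms in the four states *)

#[local] Arguments binomial : simpl never.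

Lemma natr_binS m k :
  'C(m.+1, k.+1)%:R = 'C(m, k.+1)%:R + 'C(m, k)%:R :> rat.
Proof. by rewrite binS natrD. Qed.

(** The two middle entries of row [2p + 1] are equal. *)
Lemma central_bin p : ('C(p.*2.+2, p.+1) = 2 * 'C(p.*2.+1, p))%N.
Proof.
rewrite binS -(@bin_sub p.*2.+1 p.+1); last by lia.
by rewrite (_ : (p.*2.+1 - p.+1 = p)%N); lia.
Qed.

Lemma completions_both l p h : l = (p.*2 + h)%N ->
  (completions l h true true)%:R = 2 * 'C(l, p)%:R - 'C(l.+1, p)%:R :> rat.
Proof.
elim: l p h => [|l IH] [|p] [|h] // def_l; try lia.
- by rewrite /completions count_tuples0 !bin0.
- rewrite natr_completionsS !bin0 addn1 ltnS /= completions_eq0; last by lia.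
  by rewrite (IH 0%N) ?bin0; [ring|lia].
- rewrite natr_completionsS /= (IH p); last by lia.
  have -> : l = p.*2.+1 by lia.
  by rewrite [in RHS](natr_binS p.*2.+2) central_bin natrM; ring.
- rewrite natr_completionsS addn1 ltnS /= (IH p) ?(IH p.+1); try lia.
  by rewrite 2![in RHS]natr_binS natr_binS; ring.
Qed.

(** With [M = l + 1], the terms [(h+2) C(M-1,p-1)], [h C(M-1,p)] and [2 C(M-1,p)] add up to
    [(h+2) C(M,p)]; the [- C(M,p)] of the ballot number leaves the factor [h+1]. *)
Lemma completions_1 l p h : l = (p.*2 + h)%N ->
  (completions l.+1 h true false)%:R = h.+1%:R * 'C(l.+1, p)%:R :> rat.
Proof.
elim: l p h => [|l IH] [|p] [|h] // def_l; try lia;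
  rewrite natr_completionsS addn1 /= (completions_both _ _ _ def_l).
- by rewrite completions_eq0 // !bin0; ring.
- rewrite !bin0 /= completions_eq0; last by lia.
  by rewrite (IH 0%N) ?bin0; [ring|lia].
- rewrite (IH p); last by lia.
  by rewrite natr_binS; ring.
- rewrite (IH p) ?(IH p.+1); try lia.
  by rewrite (natr_binS l.+1); ring.
Qed.

(** Height 0 must be excluded: that state already violates the second condition, yet
    [accepts 0 false true] holds of [[:: L1]]. *)
Lemma completions_1b l p h : l = (p.*2 + h)%N -> (0 < h)%N ->
  (completions l.+1 h false true)%:R = h%:R * 'C(l.+1, p)%:R :> rat.
Proof.
elim: l p h => [|l IH] [|p] [|h] // def_l _; try lia;
  rewrite natr_completionsS addn0 /= (completions_both _ _ _ def_l).
- rewrite !bin0 completions_eq0; last by lia.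
  (* At height 1 the letter [L2b] is forbidden; the formula agrees, since its term would carry the
     factor 0. *)
  case: h def_l => [|h] def_l /=; first ring.
  by rewrite (IH 0%N) ?bin0 //; [ring|lia].
- rewrite (IH p) //; last by lia.
  rewrite (natr_binS l.+1); case: h def_l => [|h] def_l /=; first ring.
  rewrite (IH p.+1) //; last by lia.
  ring.
Qed.

(** In Pascal's rule summed over [i], each entry below [p] is used twice and the entry at [p]
    once. *)
Lemma sum_binS m p :
  \sum_(i < p.+1) 'C(m.+1, i)%:R =
  2 * \sum_(i < p) 'C(m, i)%:R + 'C(m, p)%:R :> rat.
Proof.
elim: p => [|p IH]; first by rewrite big_ord_recr !big_ord0 /= !bin0; ring.
by rewrite big_ord_recr [in RHS]big_ord_recr /= IH natr_binS; ring.
Qed.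

Lemma completions_none l p h : l = (p.*2 + h)%N ->
  (completions l.+2 h false false)%:R =
  h.+1%:R * (l.+1%:R * 'C(l.+1, p)%:R - 2 * \sum_(i < p) 'C(l.+1, i)%:R) :> rat.
Proof.
elim: l p h => [|l IH] [|p] [|h] // def_l; try lia;
  rewrite natr_completionsS addn0 /= (completions_1 _ _ _ def_l).
- by rewrite completions_eq0 // !bin0 !big_ord0; ring.
- rewrite (completions_1b _ _ _ def_l) // !big_ord0 !bin0 completions_eq0; last by lia.
  rewrite (IH 0%N) ?bin0; last by lia.
  by rewrite big_ord0 /= (_ : l = h); [ring|lia].
- rewrite (IH p) ?sum_binS ?(natr_binS l.+1); last by lia.
  (* The sums cancel, and Pascal's rule leaves a combination of two adjacent entries, which their
     ratio settles. *)
  have : p.+1%:R * 'C(l.+1, p.+1)%:R = p.+2%:R * 'C(l.+1, p)%:R :> rat.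
    by rewrite -!natrM mul_bin_left; congr (_ * _)%:R; lia.
  have -> : l = p.*2.+1 by lia.
  rewrite -mul2n; move: 'C(_, p.+1)%:R 'C(_, p)%:R (\sum_(_ < _) _) => y x X.
  by rewrite -!natr1 !natrM => E; lra.
- rewrite (completions_1b _ _ _ def_l) // (IH p) ?(IH p.+1); try lia.
  rewrite (sum_binS l.+1) big_ord_recr (natr_binS l.+1) /=.
  have : p.+1%:R * 'C(l.+1, p.+1)%:R = (p + h).+3%:R * 'C(l.+1, p)%:R :> rat.
    by rewrite -!natrM mul_bin_left; congr (_ * _)%:R; lia.
  have -> : l = (p + p + h).+2 by lia.
  move: 'C(_, p.+1)%:R 'C(_, p)%:R (\sum_(_ < _) _) => y x X.
  by rewrite -!natr1 !natrD => E; lra.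
Qed.

(** Half of an odd row, by symmetry; here [sum_binS] descends two rows and the central terms
    cancel. *)
Lemma sum_bin_half p : \sum_(i < p.+1) 'C(p.*2.+1, i)%:R = 2 ^+ p.*2 :> rat.
Proof.
elim: p => [|p IH]; first by rewrite big_ord_recr big_ord0 bin0.
rewrite doubleS sum_binS central_bin.
have -> : \sum_(i < p.+1) 'C(p.*2.+2, i)%:R = 2 * 2 ^+ p.*2 - 'C(p.*2.+1, p)%:R :> rat.
  by rewrite sum_binS -IH big_ord_recr /=; ring.
by rewrite natrM !exprS; ring.
Qed.

Theorem theorem2p5 (n : nat) (n_gt0 : (0 < n)%N) :
  (G1 n)%:R = (2 * n + 1)%:R / 2 * 'C(2 * n, n)%:R - 2 ^+ (2 * n - 1) :> rat.
Proof.
case: n n_gt0 => // p _; rewrite G1_accepts.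
have := completions_none p.*2 p 0; rewrite /completions addn0 mul2n doubleS => -> //.
(* The closed form stops before the middle term [C(2p+1, p)], so that term is split off the half
   row. *)
have := sum_bin_half p; rewrite big_ord_recr /= => half.
by rewrite central_bin natrM subn1 exprS -half -mul2n; field.
Qed.
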